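(* Let $m,n$ be positive integers, let $T\subseteq\mathbb{C}$ be a finite set with $|T|=m$, and let $f:T^n\to T$ be an $m$-ary function. Then $$s(f)\leq 2\,(m-1)^3\,\deg(f)^2 .$$
   Context: For a finite set $T\subseteq\mathbb{C}$ of cardinality $m$, an $m$-ary function is a map $f:T^n\to T$. A polynomial $F\in\mathbb{C}[x_1,\ldots,x_n]$ represents $f$ if $F(\mathbf{x})=f(\mathbf{x})$ for all $\mathbf{x}\in T^n$. The degree $\deg(f)$ is the smallest total degree of a polynomial in $\mathbb{C}[x_1,\dots,x_n]$ representing $f$ (constant polynomials, including the zero polynomial, are taken to have degree $0$). The local sensitivity $s_{\mathbf{x}}(f)$ at $\mathbf{x}\in T^n$ is the number of $\mathbf{y}\in T^n$ which differ from $\mathbf{x}$ in exactly one entry and satisfy $f(\mathbf{y})\neq f(\mathbf{x})$. The sensitivity is $s(f)=\max_{\mathbf{x}\in T^n}s_{\mathbf{x}}(f)$. *)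

(* Defs.v *)
From mathcomp Require Import all_boot all_order all_algebra.
From mathcomp Require Import finmap mpoly complex boolp reals.

Set Implicit Arguments.
Unset Strict Implicit.
Unset Printing Implicit Defensive.

Import GRing.Theory.
Local Open Scope ring_scope.

Definition represents (K : fieldType) (n : nat) (T : {fset K})
    (f : {ffun 'I_n -> T} -> T) (F : {mpoly K[n]}) : Prop :=
  forall x : {ffun 'I_n -> T}, F.@[fun i => val (x i)] = val (f x).

(* [msize] is one more than the total degree of a nonzero polynomial and 0 at 0,
   so with this definition the zero polynomial has degree 0. *)
Definition tdeg (K : fieldType) (n : nat) (F : {mpoly K[n]}) : nat :=
  (msize F).-1.

Definition represented_in_degree (K : fieldType) (n : nat) (T : {fset K})
    (f : {ffun 'I_n -> T} -> T) (d : nat) : Prop :=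
  exists2 F : {mpoly K[n]}, represents f F & tdeg F = d.

(* Lagrange interpolation on the grid T^n. *)
Lemma represents_exists (K : fieldType) (n : nat) (T : {fset K})
    (f : {ffun 'I_n -> T} -> T) : exists F : {mpoly K[n]}, represents f F.
Proof.
exists (\sum_(x : {ffun 'I_n -> T}) val (f x) *:
  \prod_(i < n) \prod_(t : T | t != x i)
    ((val (x i) - val t)^-1 *: ('X_i - (val t)%:MP))) => y.
rewrite raddf_sum (bigD1 y) //= [X in _ + X]big1 ?addr0 => [|x neq_xy].
  rewrite mevalZ rmorph_prod big1 ?mulr1 // => i _.
  rewrite rmorph_prod big1 // => t neq_t.
  rewrite /= mevalZ mevalB mevalXU mevalC mulVf // subr_eq0.
  by rewrite (inj_eq val_inj) eq_sym.
have [i neq_i] : exists i, y i != x i.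
  apply/existsP; apply: contraR neq_xy; rewrite negb_exists => /forallP eq_yx.
  by apply/eqP/ffunP => i; have /negbNE/eqP := eq_yx i.
rewrite mevalZ rmorph_prod (bigD1 i) //= rmorph_prod (bigD1 (y i)) //=.
by rewrite mevalZ mevalB mevalXU mevalC subrr mulr0 !mul0r mulr0.
Qed.

Lemma degree_exists (K : fieldType) (n : nat) (T : {fset K})
    (f : {ffun 'I_n -> T} -> T) :
  exists d : nat, `[< represented_in_degree f d >].
Proof.
have [F repF] := represents_exists f.
by exists (tdeg F); apply/asboolP; exists F.
Qed.

Definition degree (K : fieldType) (n : nat) (T : {fset K})
    (f : {ffun 'I_n -> T} -> T) : nat :=
  ex_minn (degree_exists f).

Definition local_sensitivity (n : nat) (A : finType)
    (f : {ffun 'I_n -> A} -> A) (x : {ffun 'I_n -> A}) : nat :=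
  #|[set y : {ffun 'I_n -> A} |
      (#|[set i | y i != x i]| == 1%N) && (f y != f x)]|.

Definition sensitivity (n : nat) (A : finType)
    (f : {ffun 'I_n -> A} -> A) : nat :=
  \max_(x : {ffun 'I_n -> A}) local_sensitivity f x.

(* Main.v *)
(* Fix [x] and move to a random [y] in [T^n]: each coordinate is independently
   kept with probability [1 - p] and otherwise resampled uniformly in [T] minus
   its value. A polynomial [G] of degree at most [D = (m - 1) deg f] is the
   indicator of [f y <> f x], so [q p = E (G y)] is a polynomial of degree at
   most [D] in [p] with values in [0, 1] on [0, 1], [q 0 = 0], and [q' 0] is the
   local sensitivity divided by [m - 1]. Markov's inequality at the end point [0]
   gives [q' 0 <= D ^ 2].

   For the latter write [q = h X] and [P z = |1 - z|^2 / 4]. As [deg h < D], the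
   sum of [z^D h(P z)] over the [2 D]-th roots of unity vanishes, so [h 0] is
   minus the sum over [z <> 1], where [h = q / P]. The terms with [z^D = 1] are
   nonpositive, and those with [z^D = -1] are at most
   [1 / P z = |1 + z + ... + z^(D-1)|^2], whose sum is [D ^ 2] by orthogonality. *)

Require Import Defs.
From mathcomp Require Import all_boot all_order all_algebra.
From mathcomp Require Import cyclic separable cyclotomic.
From mathcomp Require Import finmap mpoly complex boolp reals.
From mathcomp Require Import ring zify.

Set Implicit Arguments.
Unset Strict Implicit.
Unset Printing Implicit Defensive.

(** * Roots of unity and Markov's inequality at an end point *)

Section EndpointMarkov.
Import GRing.Theory Num.Theory Order.TTheory.
Local Open Scope ring_scope.

(** ['X^M - 1] splits and is separable, so it has [M] distinct roots, and that many [M]-th roots of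
    unity include a primitive one. *)
Lemma prim_root_exists (C : numClosedFieldType) (M : nat) :
  (0 < M)%N -> exists z : C, M.-primitive_root z.
Proof.
move=> M_gt0; pose p : {poly C} := 'X^M - 1.
have [r Dp] := closed_field_poly_normal p.
rewrite (monicP _) ?monicXnsubC // scale1r in Dp.
have rM1 : all M.-unity_root r by apply/allP=> z; rewrite -root_prod_XsubC -Dp.
have sz_r : (M < (size r).+1)%N.
  by rewrite -(size_prod_XsubC r id) -Dp size_XnsubC.
have [|z] := hasP (has_prim_root M_gt0 rM1 _ sz_r); last by exists z.
by rewrite -separable_prod_XsubC -Dp separable_Xn_sub_1 // pnatr_eq0 -lt0n.
Qed.

Lemma sum_prim_root_exp (F : fieldType) (M : nat) (w : F) (k : nat) :
  M.-primitive_root w ->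
  \sum_(j < M) (w ^+ j) ^+ k = if (M %| k)%N then M%:R else 0.
Proof.
move=> w_prim; under eq_bigr do rewrite exprAC.
rewrite (prim_order_dvd w_prim); case: eqP => [->|/eqP wk_neq1].
  by under eq_bigr do rewrite expr1n; rewrite sumr_const card_ord.
apply/eqP; rewrite -(inj_eq (mulfI (_ : w ^+ k - 1 != 0))) ?subr_eq0 //.
by rewrite -subrX1 exprAC (prim_expr_order w_prim) expr1n subrr mulr0.
Qed.

(** In degree below [M] only the exponent 0 is divisible by [M], so all other power sums vanish. *)
Lemma sum_prim_root_horner (F : fieldType) (M : nat) (w : F) (r : {poly F}) :
  M.-primitive_root w -> (size r <= M)%N ->
  \sum_(j < M) r.[w ^+ j] = M%:R * r`_0.
Proof.
move=> w_prim le_rM; have M_gt0 := prim_order_gt0 w_prim.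
under eq_bigr do rewrite (horner_coef_wide _ le_rM).
rewrite exchange_big /=.
under eq_bigr do rewrite -mulr_sumr (sum_prim_root_exp _ w_prim).
rewrite (bigD1 (Ordinal M_gt0)) //= dvdn0 mulrC big1 ?addr0 // => k k_neq0.
rewrite gtnNdvd ?mulr0 // lt0n.
by apply: contraNneq k_neq0 => k0; apply/eqP/val_inj.
Qed.

Section UnitCircle.
Variables (C : numClosedFieldType) (D : nat).
Implicit Types z : C.

Lemma norm_unity_root M z : (0 < M)%N -> z ^+ M = 1 -> `|z| = 1.
Proof.
move=> M_gt0 zM; apply/eqP; rewrite -(@pexpr_eq1 _ _ M) //.
by rewrite -normrX zM normr1.
Qed.

(* [haversine (exp (i t)) = (1 - cos t) / 2] *)
Definition haversine z := `|1 - z| ^+ 2 / 4.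

(** On the unit circle, [D] times the Fejer kernel. *)
Definition fejer z := `|\sum_(i < D) z ^+ i| ^+ 2.

Lemma haversine1 : haversine 1 = 0.
Proof. by rewrite /haversine subrr normr0 expr0n mul0r. Qed.

Lemma haversine_gt0 z : z != 1 -> 0 < haversine z.
Proof.
by move=> z1; rewrite divr_gt0 ?exprn_gt0 ?normr_gt0 ?ltr0n // subr_eq0 eq_sym.
Qed.

Lemma haversine_le1 z : `|z| = 1 -> haversine z <= 1.
Proof.
move=> z1; rewrite ler_pdivrMr ?ltr0n // mul1r.
have -> : 4 = 2 ^+ 2 :> C by ring.
rewrite lerXn2r ?nnegrE ?ler0n //.
by apply: le_trans (ler_normB _ _) _; rewrite normr1 z1.
Qed.

(** On the unit circle conjugation is inversion, so the factor [z] turns [haversine z] into a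
    polynomial in [z]. *)
Lemma mulr_haversine z :
  `|z| = 1 -> z * haversine z = - 4^-1 * (1 - z) ^+ 2.
Proof.
move=> z1; have zz : z * z^* = 1 by rewrite -normCK z1 expr1n.
rewrite /haversine normCK rmorphB rmorph1.
have -> : z * ((1 - z) * (1 - z^*) / 4) = (1 - z) * (z - z * z^*) / 4 by ring.
by rewrite zz; ring.
Qed.

Lemma haversine_fejer z : z ^+ D = -1 -> haversine z * fejer z = 1.
Proof.
move=> zD; have two : (1 - z) * (\sum_(i < D) z ^+ i) = 2.
  by rewrite -opprB mulNr -subrX1 zD; ring.
rewrite /haversine /fejer mulrAC -exprMn -normrM two normr_nat -natrX.
by rewrite divff // pnatr_eq0.
Qed.

(** The weight is 1 where [z ^+ D = -1] and 0 where [z ^+ D = 1]. Once the square is expanded, only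
    the [D] diagonal pairs survive, and each contributes [D]. *)
Lemma sum_fejer (w : C) : (0 < D)%N -> D.*2.-primitive_root w ->
  \sum_(j < D.*2) (1 - (w ^+ j) ^+ D) / 2 * fejer (w ^+ j) = (D ^ 2)%:R.
Proof.
move=> D_gt0 w_prim; set M := D.*2.
have unitw j : (w ^+ j) ^+ M = 1.
  by rewrite exprAC (prim_expr_order w_prim) expr1n.
have conjw j k : (k <= M)%N -> ((w ^+ j) ^+ k)^* = (w ^+ j) ^+ (M - k).
  move=> le_kM; have z1 : `|(w ^+ j) ^+ k| = 1.
    by rewrite normrX (@norm_unity_root M) ?expr1n ?double_gt0 ?unitw.
  apply: (@mulfI _ ((w ^+ j) ^+ k)); first by rewrite -normr_eq0 z1 oner_eq0.
  by rewrite -normCK z1 expr1n -exprD subnKC.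
have -> : \sum_(j < M) (1 - (w ^+ j) ^+ D) / 2 * fejer (w ^+ j) =
  \sum_(i < D) \sum_(k < D) \sum_(j < M)
   2^-1 * ((w ^+ j) ^+ (i + (M - k)) - (w ^+ j) ^+ (D + (i + (M - k)))).
  rewrite [RHS](eq_bigr _ (fun i _ => exchange_big _ _ _ _ _ _)) /=.
  rewrite exchange_big; apply: eq_bigr => j _ /=.
  rewrite /fejer normCK rmorph_sum mulr_suml mulr_sumr.
  apply: eq_bigr => i _; rewrite !mulr_sumr; apply: eq_bigr => k _ /=.
  rewrite conjw; last by have := ltn_ord k; rewrite /M; lia.
  by rewrite !exprD; ring.
have -> : (D ^ 2)%:R = \sum_(i < D) \sum_(k < D) if k == i then D%:R else 0 :> C.
  under eq_bigr do rewrite -big_mkcond big_pred1_eq.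
  by rewrite sumr_const card_ord -mulrnA mulnn.
apply: eq_bigr => i _; apply: eq_bigr => k _.
rewrite -mulr_sumr sumrB !(sum_prim_root_exp _ w_prim).
have [ltiD ltkD] := (ltn_ord i, ltn_ord k).
(* As [i] and [k] differ by less than [D], this exponent lies strictly between [M] and [2 * M]. *)
have -> : (M %| D + (i + (M - k)))%N = false.
  apply/negP => /dvdnP[[|[|c]]]; rewrite /M; lia.
rewrite subr0; case: eqP => [->|/eqP neq_ki].
  rewrite subnKC ?dvdnn; last by rewrite /M; lia.
  by rewrite /M -mul2n natrM mulrA mulVf ?mul1r ?pnatr_eq0.
have -> : (M %| i + (M - k))%N = false; last by rewrite mulr0.
have neq : (k : nat) <> i by move/val_inj/eqP; apply/negP.
apply/negP => /dvdnP[[|[|c]]]; rewrite /M; lia.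
Qed.

Lemma sum_haversine (w : C) (h : {poly C}) :
    (0 < D)%N -> D.*2.-primitive_root w -> (size h <= D)%N ->
  \sum_(j < D.*2) (w ^+ j) ^+ D * h.[haversine (w ^+ j)] = 0.
Proof.
move=> D_gt0 w_prim szh.
(* By [mulr_haversine], [r.[z] = z ^+ D * h.[haversine z]] on the unit circle. As [a < D], all
   degrees in [r] lie strictly between 0 and [2 * D]. *)
pose r : {poly C} :=
  \sum_(a < D) h`_a *: ('X^(D - a) * (- 4^-1 *: (1 - 'X) ^+ 2) ^+ a).
have r0 : r`_0 = 0.
  rewrite coef_sum big1 // => a _.
  by rewrite coefZ coefXnM subn_gt0 ltn_ord mulr0.
have szr : (size r <= D.*2)%N.
  apply: leq_trans (size_sum _ _ _) _; apply/bigmax_leqP => a _.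
  apply: leq_trans (size_scale_leq _ _) _.
  have s2 : (size (- 4^-1 *: (1 - 'X : {poly C}) ^+ 2) <= 3)%N.
    apply: leq_trans (size_scale_leq _ _) _.
    apply: leq_trans (size_poly_exp_leq _ _) _.
    by rewrite -opprB size_polyN size_XsubC.
  have sa : (size ((- 4^-1 *: (1 - 'X : {poly C}) ^+ 2) ^+ a) <= (2 * a).+1)%N.
    apply: leq_trans (size_poly_exp_leq _ _) _.
    by rewrite ltnS leq_mul // -subn1 leq_subLR.
  apply: leq_trans (size_polyMleq _ _) _; rewrite size_polyXn.
  rewrite addSn /=; apply: leq_trans (leq_add (leqnn _) sa) _.
  by have := ltn_ord a; lia.
rewrite -[RHS](mulr0 D.*2%:R) -[in RHS]r0 -(sum_prim_root_horner w_prim szr).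
apply: eq_bigr => j _; set z := w ^+ j.
have z1 : `|z| = 1.
  apply: (@norm_unity_root D.*2); rewrite ?double_gt0 //.
  by rewrite exprAC (prim_expr_order w_prim) expr1n.
rewrite (horner_coef_wide _ szh) mulr_sumr horner_sum; apply: eq_bigr => a _.
rewrite hornerZ hornerM hornerXn !horner_exp hornerZ horner_exp hornerD hornerN.
rewrite hornerX hornerC -mulr_haversine // [(z * _) ^+ a]exprMn.
have -> : z ^+ D = z ^+ (D - a) * z ^+ a by rewrite -exprD subnK // ltnW.
by ring.
Qed.

End UnitCircle.

(** The order of [C] compares only numbers with real difference, so [0 <= x <= 1] ranges over the
    real unit interval. *)
Lemma markov_endpoint (C : numClosedFieldType) (D : nat) (q : {poly C}) :
    (size q <= D.+1)%N -> q.[0] = 0 ->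
    (forall x, 0 <= x <= 1 -> 0 <= q.[x] <= 1) ->
  q`_1 <= (D ^ 2)%:R.
Proof.
move=> szq q0 q01.
have [D0|D_gt0] := posnP D.
  by rewrite nth_default ?ler0n //; rewrite D0 in szq.
have [h Dq] : exists h, q = h * 'X.
  by have /factor_theorem[h] : root q 0; [apply/eqP | rewrite subr0; exists h].
have szh : (size h <= D)%N.
  have [->|h_neq0] := eqVneq h 0; first by rewrite size_poly0.
  by move: szq; rewrite Dq size_mulX.
have -> : q`_1 = h.[0] by rewrite Dq coefMX horner_coef0.
have [w w_prim] := @prim_root_exists C D.*2 (etrans (double_gt0 D) D_gt0).
have M_gt0 : (0 < D.*2)%N by rewrite double_gt0.
(* The term [z = 1] has weight 0 in the Fejer sum and is [h.[0]] in the vanishing sum; the other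
   terms are compared one by one. *)
rewrite -(sum_fejer D_gt0 w_prim) (bigD1 (Ordinal M_gt0)) //=.
rewrite expr0 expr1n subrr !mul0r add0r.
have := sum_haversine D_gt0 w_prim szh.
rewrite (bigD1 (Ordinal M_gt0)) //= expr0 expr1n mul1r haversine1 => /eqP.
rewrite addr_eq0 -sumrN => /eqP ->; apply: ler_sum => j j_neq0.
set z := w ^+ j.
have z2D : z ^+ D.*2 = 1 by rewrite exprAC (prim_expr_order w_prim) expr1n.
have z1 : `|z| = 1 by apply: norm_unity_root z2D.
have z_neq1 : z != 1.
  rewrite /z -(prim_order_dvd w_prim) gtnNdvd // lt0n.
  by apply: contraNneq j_neq0 => j0; apply/eqP/val_inj.
have hz_gt0 := haversine_gt0 z_neq1.
have /andP[] : 0 <= q.[haversine z] <= 1.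
  by apply: q01; rewrite ltW //= haversine_le1.
rewrite Dq hornerMX => qz_ge0 qz_le1.
have /eqP : (z ^+ D) ^+ 2 = 1 by rewrite -exprM muln2.
rewrite sqrf_eq1 => /orP[] /eqP zD; rewrite zD.
  by rewrite subrr !mul0r mul1r oppr_le0 -(pmulr_lge0 _ hz_gt0).
rewrite mulN1r opprK (_ : 1 - -1 = 2); last by ring.
rewrite divff ?pnatr_eq0 // mul1r -(ler_pM2r hz_gt0).
by rewrite [fejer _ _ * _]mulrC haversine_fejer.
Qed.

End EndpointMarkov.

(** * Expectation over independently resampled coordinates *)

Section Averaging.
Import GRing.Theory Num.Theory Order.TTheory.
Local Open Scope ring_scope.
Variables (C : numClosedFieldType) (n : nat) (T : {fset C}).
Variable x : {ffun 'I_n -> T}.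
Implicit Types (y : {ffun 'I_n -> T}) (G : {mpoly C[n]}) (p : C).

Let c : C := (#|{: T}|.-1)%:R^-1.

(* The probability that a random coordinate [y i] equals [t], as a polynomial in
   the probability ['X] of resampling it uniformly in [T] minus [x i]. *)
Definition resample i (t : T) : {poly C} :=
  if t == x i then 1 - 'X else c *: 'X.

(* The expectation of [G y] for independent resampled coordinates. *)
Definition average G : {poly C} :=
  \sum_(y : {ffun 'I_n -> T}) G.@[fun i => val (y i)] *: \prod_i resample i (y i).

Lemma sum_resample i : (1 < #|{: T}|)%N -> \sum_t resample i t = 1.
Proof.
move=> T_gt1; rewrite (bigD1 (x i)) //= /resample eqxx.
rewrite (eq_bigr (fun=> c *: 'X)) => [|t /negbTE -> //].
rewrite sumr_const cardC1 -scaler_nat scalerA mulfV ?scale1r ?subrK //.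
by rewrite pnatr_eq0 -lt0n -ltnS prednK // ltnW.
Qed.

(** By independence, the expectation of a monomial is the product of the expectations of its
    powers. *)
Lemma averageE G : average G = \sum_(m <- msupp G)
  G@_m *: \prod_i \sum_t (val t ^+ m i) *: resample i t.
Proof.
under [RHS]eq_bigr => m _ do rewrite bigA_distr_bigA /= scaler_sumr.
rewrite exchange_big /=; apply: eq_bigr => y _; rewrite mevalE scaler_suml.
apply: eq_bigr => m _; rewrite -scalerA; congr (_ *: _).
by rewrite -scaler_prod.
Qed.

Lemma size_average G : (1 < #|{: T}|)%N -> (size (average G) <= msize G)%N.
Proof.
move=> T_gt1; rewrite averageE big_seq.
apply: leq_trans (size_sum _ _ _) _; apply/bigmax_leqP_seq => m _ mG.
apply: leq_trans (size_scale_leq _ _) _.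
apply: leq_trans (size_poly_prod_leq _ _) _; rewrite leq_subLR.
(* A factor is the constant 1 when [m i = 0], as the probabilities sum to 1, and has degree at most
   1 otherwise. *)
apply: leq_trans (_ : (\sum_(i < n) (1 + m i)).+1 <= _)%N.
  rewrite ltnS; apply: leq_sum => i _.
  case: (m i) => [|k].
    under eq_bigr do rewrite expr0 scale1r.
    by rewrite sum_resample // size_poly1.
  apply: leq_trans (_ : 2 <= _)%N; last by rewrite add1n.
  apply: leq_trans (size_sum _ _ _) _; apply/bigmax_leqP => t _.
  apply: leq_trans (size_scale_leq _ _) _; rewrite /resample.
  case: ifP => _; first by rewrite -opprB size_polyN size_XsubC.
  by apply: leq_trans (size_scale_leq _ _) _; rewrite size_polyX.
rewrite big_split /= sum1_card -mdegE -addnS leq_add //.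
exact: msize_mdeg_lt.
Qed.

(** For such [p] the value is a convex combination of values of [G]. *)
Lemma average_itv01 G p : (1 < #|{: T}|)%N -> 0 <= p <= 1 ->
  (forall y, 0 <= G.@[fun i => val (y i)] <= 1) -> 0 <= (average G).[p] <= 1.
Proof.
move=> T_gt1 /andP[p_ge0 p_le1] G01.
have w_ge0 y : 0 <= (\prod_i resample i (y i)).[p].
  rewrite horner_prod prodr_ge0 // => i _; rewrite /resample; case: ifP => _.
    by rewrite hornerD hornerN hornerX hornerC subr_ge0.
  by rewrite hornerZ hornerX mulr_ge0 ?invr_ge0 ?ler0n.
rewrite /average horner_sum sumr_ge0 => [|y _]; last first.
  by rewrite hornerZ mulr_ge0 //; case/andP: (G01 y).
apply: le_trans (_ : \sum_(y : {ffun 'I_n -> T}) (\prod_i resample i (y i)).[p] <= _).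
  by apply: ler_sum => y _; rewrite hornerZ ler_piMl //; case/andP: (G01 y).
rewrite -horner_sum -(bigA_distr_bigA resample) big1 ?hornerC // => i _.
exact: sum_resample.
Qed.

Lemma prod_resample y (k := #|[set i | y i != x i]|) :
  \prod_i resample i (y i) =
  c ^+ k *: ('X^k * (1 - 'X) ^+ #|[set i | y i == x i]|).
Proof.
rewrite (bigID [pred i | y i == x i]) /= mulrC.
rewrite (eq_bigr (fun=> c *: 'X)) => [|i /negbTE yi]; last by rewrite /resample yi.
rewrite [X in _ * X](eq_bigr (fun=> 1 - 'X)) => [|i yi]; last by rewrite /resample yi.
by rewrite !prodr_const exprZn -scalerAl /k !cardsE.
Qed.

Lemma average0 G : (average G).[0] = G.@[fun i => val (x i)].
Proof.
rewrite horner_sum (bigD1 x) //= [X in _ + X]big1 => [|y yx]; last first.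
  have [i yi] : exists i, y i != x i.
    apply/existsP; apply: contraR yx; rewrite negb_exists => /forallP eq_yx.
    by apply/eqP/ffunP => i; have /negbNE/eqP := eq_yx i.
  rewrite hornerZ horner_prod (bigD1 i) //= /resample (negbTE yi).
  by rewrite hornerZ hornerX mulr0 mul0r mulr0.
rewrite addr0 hornerZ horner_prod big1 ?mulr1 // => i _.
by rewrite /resample eqxx hornerD hornerN hornerX hornerC subr0.
Qed.

(** The weight of [y] is divisible by ['X] to the Hamming distance from [x]: distances above 1 do
    not reach degree 1, and distance 0 contributes a multiple of the value of [G] at [x]. *)
Lemma coef1_average G : G.@[fun i => val (x i)] = 0 ->
  (average G)`_1 = (\sum_(y : {ffun 'I_n -> T} | #|[set i | y i != x i]| == 1%N)
    G.@[fun i => val (y i)]) / (#|{: T}|.-1)%:R.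
Proof.
move=> Gx; rewrite coef_sum mulr_suml [RHS]big_mkcond; apply: eq_bigr => y _.
rewrite coefZ prod_resample coefZ coefXnM.
have [->|dist1] := eqVneq #|[set i | y i != x i]| 1%N.
  by rewrite ltnn subnn -horner_coef0 horner_exp hornerD hornerN hornerX hornerC
             subr0 expr1n mulr1 expr1.
case: ltnP => [_|]; first by rewrite !mulr0.
rewrite leq_eqVlt (negbTE dist1) ltnS leqn0 cards_eq0 => /eqP eq_yx.
suff -> : y = x by rewrite Gx mul0r.
apply/ffunP => i; apply/eqP/negbNE/negP => yi.
by have := in_set0 i; rewrite -eq_yx inE yi.
Qed.

End Averaging.

(** * Indicator polynomials and the sensitivity bound *)

Section Sensitivity.
Import GRing.Theory Num.Theory Order.TTheory.
Local Open Scope ring_scope.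

Lemma represents_indicator (K : fieldType) (n : nat) (T : {fset K})
    (f : {ffun 'I_n -> T} -> T) (F : {mpoly K[n]}) (a : T) :
    represents f F ->
  exists2 G : {mpoly K[n]}, (msize G <= (#|{: T}|.-1 * tdeg F).+1)%N &
    forall y : {ffun 'I_n -> T}, G.@[fun i => val (y i)] = (f y != a)%:R.
Proof.
move=> repF.
(* The Lagrange polynomial of [a] on [T], composed with [F]: 1 where [f y = a], 0 elsewhere. *)
pose L := \prod_(t | t != a) ((val a - val t)^-1 *: (F - (val t)%:MP)).
exists (1 - L) => [|y].
  have szFt (t : T) : (msize (F - (val t)%:MP) <= (tdeg F).+1)%N.
    apply: leq_trans (mmeasureD_le _ _ _) _; rewrite geq_max mmeasureN mmeasureC.
    by rewrite /tdeg leqSpred; case: (_ != _).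
  have szL : (msize L <= (#|{: T}|.-1 * tdeg F).+1)%N.
    rewrite -(cardC1 a) -sum1_card big_distrl /= /L.
    elim/big_rec2: _ => [|t d p _ IH]; first by rewrite msize1.
    have [->|p0] := eqVneq p 0; first by rewrite mulr0 mmeasure0.
    have [->|Ft0] := eqVneq ((val a - val t)^-1 *: (F - (val t)%:MP)) 0.
      by rewrite mul0r mmeasure0.
    rewrite msizeM //.
    rewrite mul1n -subn1 leq_subLR add1n -addnS -addSn leq_add //.
    exact: leq_trans (msizeZ_le _ _) (szFt t).
  apply: leq_trans (mmeasureD_le _ _ _) _.
  by rewrite geq_max mmeasureN szL mmeasure1.
rewrite mevalB meval1 rmorph_prod /=.
have [fya|fya] := eqVneq (f y) a; last first.
  rewrite (bigD1 (f y)) //= mevalZ mevalB mevalC repF subrr mulr0 mul0r.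
  by rewrite subr0.
rewrite big1 ?subrr // => t ta.
rewrite mevalZ mevalB mevalC repF fya mulVf // subr_eq0 (inj_eq val_inj).
by rewrite eq_sym.
Qed.

Lemma local_sensitivity_le (C : numClosedFieldType) (n : nat) (T : {fset C})
    (f : {ffun 'I_n -> T} -> T) (x : {ffun 'I_n -> T}) :
  (local_sensitivity f x <= #|{: T}|.-1 ^ 3 * degree f ^ 2)%N.
Proof.
rewrite /degree; case: ex_minnP => d /asboolP[F repF <-] _.
(* With at most one value [f] is constant; resampling requires a second element of [T]. *)
have [T_le1|T_gt1] := leqP #|{: T}| 1.
  rewrite [local_sensitivity f x](_ : _ = 0%N) //; apply/eqP.
  rewrite cards_eq0 -subset0; apply/subsetP => y; rewrite inE => /andP[_ /eqP[]].
  exact: (card_le1_eqP T_le1).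
have [G szG Gf] := represents_indicator (f x) repF.
have Gx : G.@[fun i => val (x i)] = 0 by rewrite Gf eqxx.
have := markov_endpoint (leq_trans (size_average x G T_gt1) szG).
rewrite average0 coef1_average // => /(_ Gx) Gbound.
have {Gbound} := Gbound _.
under eq_bigr do rewrite Gf.
rewrite -natr_sum ler_pdivrMr ?ltr0n; last by rewrite -ltnS prednK // ltnW.
rewrite -natrM ler_nat => Gbound.
rewrite [local_sensitivity f x](_ : _ =
  \sum_(y : {ffun 'I_n -> T} | #|[set i | y i != x i]| == 1%N) (f y != f x))%N.
  (* The cube is the squared factor [#|{: T}|.-1] of the degree bound times the cleared
     denominator. *)
  apply: leq_trans (Gbound _) _; last by rewrite expnMn mulnAC -expnSr.
  move=> p p01; apply: average_itv01 => // y.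
  by rewrite Gf ler0n lern1; case: (_ != _).
rewrite /local_sensitivity -sum1_card big_mkcond [RHS]big_mkcond.
apply: eq_bigr => y _; rewrite inE.
by case: (_ == 1%N); case: (_ != _).
Qed.

End Sensitivity.

Theorem theorem1p1 (R : realType) (m n : nat) (m_gt0 : 0 < m) (n_gt0 : 0 < n)
    (T : {fset R[i]}) (card_T : #|` T| = m) (f : {ffun 'I_n -> T} -> T) :
  sensitivity f <= 2 * (m - 1) ^ 3 * degree f ^ 2.
Proof.
apply/bigmax_leqP => x _; apply: leq_trans (local_sensitivity_le f x) _.
by rewrite -cardfE card_T subn1 -mulnA leq_pmull.
Qed.
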